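(* Let $K$ be an arbitrary field, $R$ a $K$-algebra, and $J$ an ideal of $R$. If $J$ is locally unit-regular and $R/J$ is locally f.d.ss, then $R$ is locally unit-regular. In particular, every extension of a locally f.d.ss $K$-algebra by a locally f.d.ss $K$-algebra is locally unit-regular.
   Context: Algebras are associative, not necessarily unital $K$-algebras; ideals are two-sided ring ideals that are $K$-subspaces. A $K$-algebra $R$ is locally f.d.ss if every finite subset of $R$ is contained in a subalgebra of $R$ that is a finite dimensional semisimple $K$-algebra. A unital ring $S$ is unit-regular if for each $x\in S$ there is a unit $u$ of $S$ with $xux = x$. A $K$-algebra $R$ is locally unit-regular if every finite subset of $R$ is contained in a $K$-subalgebra of $R$ that has its own identity element and is unit-regular. An extension of $A$ by $C$ is an algebra $B$ with an ideal $J \cong A$ and $B/J \cong C$. *)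

(* Defs.v *)
From HB Require Import structures.
From mathcomp Require Import all_boot all_order all_algebra.
Set Implicit Arguments. Unset Strict Implicit. Unset Printing Implicit Defensive.
Import GRing.Theory.
Local Open Scope ring_scope.

Record nalg (K : fieldType) := NAlg {
  nalg_sort :> lmodType K;
  nmul : nalg_sort -> nalg_sort -> nalg_sort;
  nmulA : forall x y z, nmul x (nmul y z) = nmul (nmul x y) z;
  nmulDl : forall x y z, nmul (x + y) z = nmul x z + nmul y z;
  nmulDr : forall x y z, nmul x (y + z) = nmul x y + nmul x z;
  nmulZl : forall (a : K) x y, nmul (a *: x) y = a *: nmul x y;
  nmulZr : forall (a : K) x y, nmul x (a *: y) = a *: nmul x y
}.
Arguments nmul {K} n _ _.

Section Defs.
Variables (K : fieldType) (R : nalg K).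

Local Notation "x ** y" := (nmul R x y) (at level 40, left associativity).

Definition subspace (S : R -> Prop) : Prop :=
  S 0 /\ forall (a : K) x y, S x -> S y -> S (a *: x + y).

Definition subalg (S : R -> Prop) : Prop :=
  subspace S /\ forall x y, S x -> S y -> S (x ** y).

Definition ideal (J : R -> Prop) : Prop :=
  subspace J /\ forall r x, J x -> J (r ** x) /\ J (x ** r).

Definition ideal_in (S I : R -> Prop) : Prop :=
  (forall x, I x -> S x) /\ subspace I /\
  forall s x, S s -> I x -> I (s ** x) /\ I (x ** s).

Fixpoint nprod (x : R) (s : seq R) : R :=
  match s with [::] => x | y :: s' => x ** nprod y s' end.

(* I^(n+1) = 0 for some n: every product of n+1 elements of I vanishes *)
Definition nilpotent (I : R -> Prop) : Prop :=
  exists n : nat, forall x (s : seq R), size s = n -> I x ->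
    (forall y, y \in s -> I y) -> nprod x s = 0.

Definition fin_dim (S : R -> Prop) : Prop :=
  exists s : seq R, (forall y, y \in s -> S y) /\
    forall x, S x -> exists c : 'I_(size s) -> K,
      x = \sum_(i < size s) c i *: s`_i.

(* S is a finite dimensional semisimple subalgebra (Wedderburn: no nonzero
   nilpotent ideals) *)
Definition fdss_subalg (S : R -> Prop) : Prop :=
  subalg S /\ fin_dim S /\
  forall I, ideal_in S I -> nilpotent I -> forall x, I x -> x = 0.

Definition unit_regular_subalg (S : R -> Prop) : Prop :=
  subalg S /\ exists e, S e /\ (forall x, S x -> e ** x = x /\ x ** e = x) /\
    forall x, S x -> exists u v, S u /\ S v /\ u ** v = e /\ v ** u = e /\
      (x ** u) ** x = x.

(* The subalgebra A of R (A = R is the case fun _ => True) is locally f.d.ss *)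
Definition loc_fdss (A : R -> Prop) : Prop :=
  forall F : seq R, (forall x, x \in F -> A x) ->
    exists S : R -> Prop, (forall x, S x -> A x) /\
      (forall x, x \in F -> S x) /\ fdss_subalg S.

Definition loc_unit_regular (A : R -> Prop) : Prop :=
  forall F : seq R, (forall x, x \in F -> A x) ->
    exists S : R -> Prop, (forall x, S x -> A x) /\
      (forall x, x \in F -> S x) /\ unit_regular_subalg S.

End Defs.

Definition nhom (K : fieldType) (A B : nalg K) (f : A -> B) : Prop :=
  (forall (a : K) x y, f (a *: x + y) = a *: f x + f y) /\
  (forall x y, f (nmul A x y) = nmul B (f x) (f y)).

Definition is_extension (K : fieldType) (A B C : nalg K) : Prop :=
  exists J : B -> Prop, ideal J /\
    (exists phi : A -> B, nhom phi /\ injective phi /\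
       forall y, J y <-> exists x, y = phi x) /\
    (exists psi : B -> C, nhom psi /\ (forall z, exists y, psi y = z) /\
       forall y, psi y = 0 <-> J y).

(* Main.v *)
From HB Require Import structures.
From Stdlib Require Import Classical.
Require Import Defs.
From mathcomp Require Import all_boot all_order all_algebra.
Set Implicit Arguments. Unset Strict Implicit. Unset Printing Implicit Defensive.
Import GRing.Theory.
Local Open Scope ring_scope.

(* Let [S] be a finite dimensional semisimple subalgebra of [R/J] containing
   the image of the given finite set, and let [R0] be its preimage in [R].
   Being semiprime, [S] is von Neumann regular; so [R0] is regular too, and the
   finite set lies in a corner [g R0 g] with [g] idempotent. This corner is the
   required unit-regular subalgebra. To see it one proves a stable range
   condition in the unitization [K + R0]: if [x y x = x] then
   [x + (1 - x y) t] is a unit for some [t]. Modulo [J] this holds by dimension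
   counting in [K + S]. A unit of [K + S] has its inverse among its own
   polynomials, and for that reason it lifts to a unit of [K + R0]; dividing by
   the lift leaves an element of [1 + J], for which the condition is solved
   inside a unit-regular subalgebra of [J]. *)

(** * Subspaces as predicates *)

Section LinearPredicates.
Variables (K : fieldType) (V : lmodType K).

Definition lsub (U : V -> Prop) : Prop :=
  U 0 /\ forall (a : K) x y, U x -> U y -> U (a *: x + y).

Definition lspan (s : seq V) (x : V) : Prop :=
  exists c : 'I_(size s) -> K, x = \sum_(i < size s) c i *: s`_i.

Lemma lsubD U x y : lsub U -> U x -> U y -> U (x + y).
Proof. by move=> [_ h] hx hy; rewrite -[x]scale1r; apply: h. Qed.

Lemma lsubZ U a x : lsub U -> U x -> U (a *: x).
Proof. by move=> [h0 h] hx; rewrite -[a *: x]addr0; apply: h. Qed.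

Lemma lsubB U x y : lsub U -> U x -> U y -> U (x - y).
Proof.
by move=> hU hx hy; apply: lsubD => //; rewrite -scaleN1r; apply: lsubZ.
Qed.

End LinearPredicates.

(** Vectors of [U] outside [X] are adjoined one at a time; each raises the dimension, so [m], which
    exceeds the room left above [X], runs out. *)
Lemma lsub_vspace (K : fieldType) (V : vectType K) (U : V -> Prop) :
  lsub U -> exists X : {vspace V}, forall v, v \in X <-> U v.
Proof.
move=> hU.
suff H m (X : {vspace V}) : (\dim {: V} < \dim X + m)%N ->
    (forall v, v \in X -> U v) ->
    exists X : {vspace V}, forall v, v \in X <-> U v.
  apply: (H (\dim {: V}).+1 0%VS); first by rewrite dimv0.
  by move=> v; rewrite memv0 => /eqP ->; case: hU.
elim: m X => [|m IHm] X hd hX.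
  by move: hd; rewrite addn0 ltnNge dimvS ?subvf.
have [hall|/not_all_ex_not [v hv]] := classic (forall v, U v -> v \in X).
  by exists X => v; split; [apply: hX | apply: hall].
have {hv} [Uv nXv] : U v /\ ~ (v \in X) by apply: imply_to_and hv.
apply: (IHm (X + <[v]>)%VS).
  apply: leq_trans hd _; rewrite addnS -addSn leq_add2r.
  have le := addvSl X <[v]>%VS.
  rewrite (ltn_leqif (dimv_leqif_eq le)); apply/eqP => eqX; apply: nXv.
  by rewrite eqX memvE addvSr.
move=> w /memv_addP [x xX [y /vlineP [k ->] ->]].
by apply: lsubD => //; [apply: hX | apply: lsubZ].
Qed.

(** * Chain conditions in a finitely spanned space *)

Section ChainConditions.
Variables (K : fieldType) (V : lmodType K) (s : seq V).

Definition in_span (U : V -> Prop) : Prop :=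
  lsub U /\ forall x, U x -> lspan s x.

Let comb (v : 'rV[K]_(size s)) : V := \sum_(i < size s) v 0 i *: s`_i.

(* The dimension is measured on the preimage of [U] under the presentation
   [comb], so that [s] need not be linearly independent. *)
Let has_dim (U : V -> Prop) (k : nat) : Prop :=
  exists2 X : {vspace 'rV[K]_(size s)},
    (forall v, v \in X <-> U (comb v)) & \dim X = k.

Let has_dim_ex U : in_span U -> exists k, has_dim U k.
Proof.
move=> [hU _].
have [|X hX] := @lsub_vspace K 'rV[K]_(size s) (fun v => U (comb v)).
  split=> [|a x y hx hy].
    rewrite /comb big1; first by case: hU.
    by move=> i _; rewrite mxE scale0r.
  suff -> : comb (a *: x + y) = a *: comb x + comb y by apply: hU.2.
  rewrite /comb scaler_sumr -big_split /=; apply: eq_bigr => i _.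
  by rewrite !mxE scalerDl scalerA.
by exists (\dim X), X.
Qed.

Let has_dim_le U k : has_dim U k -> (k <= size s)%N.
Proof.
move=> [X _ <-]; apply: leq_trans (dimvS (subvf X)) _.
by rewrite dimvf /dim /= mul1n.
Qed.

Let has_dim_sub U W k l : in_span U -> has_dim U k -> has_dim W l ->
  (forall x, W x -> U x) -> (k <= l)%N -> forall x, U x -> W x.
Proof.
move=> [_ hs] [X hX <-] [Y hY <-] hWU le x Ux.
have sYX : (Y <= X)%VS by apply/subvP => v /hY /hWU /hX.
have eqYX : Y = X by apply/eqP; rewrite eqEdim sYX.
have [c ec] := hs x Ux.
have ecomb : x = comb (\row_i c i).
  by rewrite ec /comb; apply: eq_bigr => i _; rewrite mxE.
by rewrite ecomb; apply/hY; rewrite eqYX; apply/hX; rewrite -ecomb.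
Qed.

(** Strong induction on the dimension: a member of [C] inside [U] either has smaller dimension, and
    the induction hypothesis applies to it, or equals [U] by [has_dim_sub]. *)
Lemma exists_minimal (C : (V -> Prop) -> Prop) :
  (forall U, C U -> in_span U) -> (exists U, C U) ->
  exists U, C U /\
    forall W, C W -> (forall x, W x -> U x) -> forall x, U x -> W x.
Proof.
move=> hC [U0 CU0].
suff H k U : C U -> has_dim U k -> exists U, C U /\
    forall W, C W -> (forall x, W x -> U x) -> forall x, U x -> W x.
  by have [k hk] := has_dim_ex (hC _ CU0); apply: (H k U0).
elim/ltn_ind: k U => k IHk U CU hk; apply: NNPP => hn; apply: (hn).
exists U; split=> // W CW hWU.
have [l hl] := has_dim_ex (hC _ CW).
apply: (has_dim_sub (hC _ CU) hk hl hWU); rewrite leqNgt; apply/negP => lk.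
by apply: hn; apply: (IHk l lk W).
Qed.

(** Dimensions are at most [size s], so the dual induction runs on [m], which exceeds the room
    [size s - k] left above [U]. *)
Lemma exists_maximal (C : (V -> Prop) -> Prop) :
  (forall U, C U -> in_span U) -> (exists U, C U) ->
  exists U, C U /\
    forall W, C W -> (forall x, U x -> W x) -> forall x, W x -> U x.
Proof.
move=> hC [U0 CU0].
suff H m U k : (size s < k + m)%N -> C U -> has_dim U k -> exists U, C U /\
    forall W, C W -> (forall x, U x -> W x) -> forall x, W x -> U x.
  have [k hk] := has_dim_ex (hC _ CU0).
  by apply: (H (size s).+1 U0 k) => //; rewrite addnS ltnS leq_addl.
elim: m U k => [|m IHm] U k lm CU hk.
  by move: lm; rewrite addn0 ltnNge (has_dim_le hk).
apply: NNPP => hn; apply: (hn).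
exists U; split=> // W CW hUW.
have [l hl] := has_dim_ex (hC _ CW).
apply: (has_dim_sub (hC _ CW) hl hk hUW); rewrite leqNgt; apply/negP => lk.
apply: hn; apply: (IHm W l) => //.
by apply: leq_trans lm _; rewrite addnS -addSn leq_add2r.
Qed.

End ChainConditions.

(** * Regular and unit-regular subalgebras *)

Section Subalgebras.
Variables (K : fieldType) (B : algType K).

Definition nsubalg (S : B -> Prop) : Prop :=
  lsub S /\ forall x y, S x -> S y -> S (x * y).

Definition regular (S : B -> Prop) : Prop :=
  forall x, S x -> exists2 y, S y & x * y * x = x.

Definition unit_regular (S : B -> Prop) : Prop :=
  nsubalg S /\ exists e, S e /\ (forall x, S x -> e * x = x /\ x * e = x) /\
    forall x, S x -> exists u v, S u /\ S v /\ u * v = e /\ v * u = e /\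
      x * u * x = x.

(** Both [x (1 - y x)] and [(1 - x y) x] equal the defect [x - x y x], so a quasi-inverse [z] of the
    defect supplies exactly the missing term. This is used when the defect lies in a regular
    ideal. *)
Lemma regular_correction (x y z : B) :
  (x - x * y * x) * z * (x - x * y * x) = x - x * y * x ->
  x * (y + (1 - y * x) * z * (1 - x * y)) * x = x.
Proof.
move=> h; rewrite mulrDr mulrDl.
have -> : x * ((1 - y * x) * z * (1 - x * y)) * x =
          (x - x * y * x) * z * (x - x * y * x).
  have -> : x * ((1 - y * x) * z * (1 - x * y)) * x =
            (x * (1 - y * x)) * z * ((1 - x * y) * x) by rewrite !mulrA.
  by rewrite [x * (1 - _)]mulrBr [(1 - _) * x]mulrBl mulr1 mul1r mulrA.
by rewrite h addrC subrK.
Qed.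

(** The join fixes [e] and [f] under left multiplication, hence also itself; it is a left unit for
    [e B + f B]. *)
Lemma idem_join (e f : B) : e * e = e -> f * f = f -> e * f = 0 ->
  (e + f - f * e) * (e + f - f * e) = e + f - f * e.
Proof.
move=> ee ff ef; set g := e + f - f * e.
have ge : g * e = e by rewrite /g mulrBl mulrDl -mulrA ee addrK.
have gf : g * f = f by rewrite /g mulrBl mulrDl -mulrA ef ff mulr0 subr0 add0r.
by rewrite {2}/g mulrBr mulrDr mulrA ge gf.
Qed.

(* Writing [al w al = al] with [w] a unit and [g = al w], take
   [t = (e - g) w^-1]: then [al + ga t = (e + g ga (e - g)) w^-1], and
   [g ga (e - g)] has square zero. *)
Lemma unit_regular_stable_range1 S : unit_regular S ->
  exists e, S e /\ (forall x, S x -> e * x = x /\ x * e = x) /\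
  forall al be ga, S al -> S be -> S ga -> al * be + ga = e ->
  exists t v, S t /\ S v /\ (al + ga * t) * v = e /\ v * (al + ga * t) = e.
Proof.
move=> [[Sl SM] [e [Se [idS reg]]]]; exists e; split=> //; split=> //.
move=> al be ga Sal Sbe Sga eqn.
have [w [w' [Sw [Sw' [ww' [w'w alw]]]]]] := reg _ Sal.
have ide x (Sx : S x) : e * x = x by case: (idS x Sx).
have eid x (Sx : S x) : x * e = x by case: (idS x Sx).
set g := al * w; have Sg : S g by apply: SM.
have gg : g * g = g by rewrite /g mulrA alw.
have gw' : g * w' = al by rewrite /g -mulrA ww' eid.
set k := e - g; have Sk : S k by apply: lsubB.
have gk : g * k = 0 by rewrite mulrBr eid // gg subrr.
have gDk : g + k = e by rewrite /k addrC subrK.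
have kk : k * k = k by rewrite {1}/k mulrBl ide // gk subr0.
have kal : k * al = 0 by rewrite -gw' mulrA mulrBl ide // gg subrr mul0r.
have kga : k * ga = k.
  have : k * (al * be + ga) = k * e by rewrite eqn.
  by rewrite mulrDr mulrA kal mul0r add0r eid.
set n := g * ga * k; have Sn : S n by rewrite /n; apply: (SM) => //; apply: SM.
have nn : n * n = 0.
  have -> : n * n = g * ga * (k * g) * (ga * k) by rewrite /n !mulrA.
  by rewrite mulrBl ide // gg subrr mulr0 mul0r.
have key : al + ga * (k * w') = (e + n) * w'.
  have -> : e + n = g + ga * k.
    have -> : ga * k = (g + k) * (ga * k).
      by rewrite gDk ide //; apply: SM.
    by rewrite mulrDl [k * _]mulrA kga kk [g * _]mulrA -/n addrCA gDk addrC.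
  by rewrite [RHS]mulrDl gw' mulrA.
exists (k * w'), (w * (e - n)); split; first exact: SM.
split; first by apply: SM => //; apply: lsubB.
rewrite key; split.
  rewrite mulrA -(mulrA _ w') w'w eid; last exact: lsubD.
  by rewrite mulrBr !mulrDl ide // eid // nn addr0 ide // addrK.
rewrite -mulrA (mulrA (e - n)) mulrBl !mulrDr ide // eid // nn addr0 ide //.
by rewrite addrK ide.
Qed.

(** * Idempotent units for finite subsets of a regular algebra *)

Section FaithUtumi.
Variable S : B -> Prop.
Hypotheses (hS : nsubalg S) (regS : regular S).

(** Induction on [F]: [e] kills [x - e x], so [f = (x - e x) y] is an idempotent with [e f = 0], and
    the join of [e] and [f] is a left unit for the old elements and for [x = e x + (x - e x)]. *)
Lemma left_unit_idem (F : seq B) : (forall x, x \in F -> S x) ->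
  exists g, S g /\ g * g = g /\ forall x, x \in F -> g * x = x.
Proof.
case: hS => Sl SM.
elim: F => [|x F IHF] hF.
  by exists 0; split; [case: Sl | rewrite mul0r].
have [|e [Se [ee he]]] := IHF.
  by move=> y yF; apply: hF; rewrite inE yF orbT.
have Sx : S x by apply: hF; rewrite inE eqxx.
have Sx' : S (x - e * x) by apply: lsubB => //; apply: SM.
have [y Sy hy] := regS Sx'.
set f := (x - e * x) * y in hy.
have ex' : e * (x - e * x) = 0 by rewrite mulrBr mulrA ee subrr.
have ef : e * f = 0 by rewrite /f mulrA ex' mul0r.
have ff : f * f = f by rewrite {2}/f mulrA hy.
have Sf : S f by apply: SM.
clearbody f.
exists (e + f - f * e); split.
  by apply: lsubB => //; [apply: lsubD | apply: SM].
split; first exact: idem_join.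
move=> z; rewrite inE => /orP [/eqP ->|zF].
  have -> : (e + f - f * e) * x = e * x + f * (x - e * x).
    by rewrite mulrBl mulrDl mulrBr addrA mulrA.
  by rewrite hy addrC subrK.
by rewrite mulrBl mulrDl -mulrA (he _ zF) addrK.
Qed.

Lemma right_unit_idem (F : seq B) : (forall x, x \in F -> S x) ->
  exists g, S g /\ g * g = g /\ forall x, x \in F -> x * g = x.
Proof.
case: hS => Sl SM.
elim: F => [|x F IHF] hF.
  by exists 0; split; [case: Sl | rewrite mul0r].
have [|e [Se [ee he]]] := IHF.
  by move=> y yF; apply: hF; rewrite inE yF orbT.
have Sx : S x by apply: hF; rewrite inE eqxx.
have Sx' : S (x - x * e) by apply: lsubB => //; apply: SM.
have [y Sy] := regS Sx'; rewrite -mulrA => hy.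
set f := y * (x - x * e) in hy.
have ex' : (x - x * e) * e = 0 by rewrite mulrBl -mulrA ee subrr.
have fe : f * e = 0 by rewrite /f -mulrA ex' mulr0.
have ff : f * f = f by rewrite {1}/f -mulrA hy.
have Sf : S f by apply: SM.
clearbody f.
exists (f + e - e * f); split.
  by apply: lsubB => //; [apply: lsubD | apply: SM].
split; first exact: idem_join.
move=> z; rewrite inE => /orP [/eqP ->|zF].
  have -> : x * (f + e - e * f) = x * e + (x - x * e) * f.
    by rewrite mulrBr mulrDr mulrBl mulrA addrCA addrA.
  by rewrite hy addrC subrK.
by rewrite mulrBr mulrDr mulrA (he _ zF) addrAC subrr add0r.
Qed.

(** Including [g] in the list for the right unit [g'] gives [g g' = g], which makes [g + g' - g' g]
    idempotent; on [F] it acts from the left as [g] does and from the right as [g'] does. *)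
Lemma two_sided_unit_idem (F : seq B) : (forall x, x \in F -> S x) ->
  exists g, S g /\ g * g = g /\ forall x, x \in F -> g * x = x /\ x * g = x.
Proof.
move=> hF; case: (hS) => Sl SM.
have [g [Sg [gg hg]]] := left_unit_idem hF.
have [|g' [Sg' [gg' hg']]] := @right_unit_idem (g :: F).
  by move=> x; rewrite inE => /orP [/eqP ->|/hF].
have gg'g : g * g' = g by apply: hg'; rewrite inE eqxx.
exists (g + g' - g' * g); split.
  by apply: lsubB => //; [apply: lsubD | apply: SM].
split.
  set h := _ - _.
  have hh : g * h = g by rewrite mulrBr mulrDr gg gg'g mulrA gg'g gg addrK.
  have hh' : g' * h = g'.
    by rewrite mulrBr mulrDr gg' mulrA gg' addrAC subrr add0r.
  by rewrite {1}/h mulrBl mulrDl -mulrA hh hh'.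
move=> x xF; have xg' : x * g' = x by apply: hg'; rewrite inE xF orbT.
split; first by rewrite mulrBl mulrDl -mulrA (hg _ xF) addrK.
by rewrite mulrBr mulrDr mulrA xg' addrAC subrr add0r.
Qed.

End FaithUtumi.
End Subalgebras.

(** * Consequences of finite dimension *)

Section FiniteDimensional.
Variables (K : fieldType) (B : algType K) (s : seq B).

(** Fitting's argument: the kernels of the powers of [u] on [U] stabilize at some [k]. Writing
    [x = u^k y], the equation [u x = 0] puts [y] in the kernel of [u^(k+1)], hence of [u^k]. *)
Lemma in_span_surj_inj (U : B -> Prop) (u : B) : in_span s U ->
  (forall x, U x -> U (u * x)) ->
  (forall x, U x -> exists2 y, U y & x = u * y) ->
  forall x, U x -> u * x = 0 -> x = 0.
Proof.
move=> [[U0 Ulin] Us] hu hsurj.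
pose C W := exists k, forall x, W x <-> U x /\ u ^+ k * x = 0.
have [W CW||W [[k hk] maxW]] := @exists_maximal K B s C.
- have [k hk] := CW; split; last by move=> x /hk [/Us].
  split; first by apply/hk; rewrite mulr0.
  move=> a x y /hk [Ux hx] /hk [Uy hy]; apply/hk; split; first exact: Ulin.
  by rewrite mulrDr -scalerAr hx hy scaler0 addr0.
- by exists (fun x => U x /\ u ^+ 0 * x = 0), 0.
move=> x Ux ux0.
have surj_iter j : exists2 y, U y & x = u ^+ j * y.
  elim: j => [|j [y Uy ->]]; first by exists x; rewrite ?mul1r.
  by have [z Uz ->] := hsurj y Uy; exists z; rewrite // exprSr mulrA.
have [y Uy xy] := surj_iter k.
suff /hk [_] : W y by rewrite -xy.
apply: (maxW (fun y => U y /\ u ^+ k.+1 * y = 0)); first by exists k.+1.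
  by move=> z /hk [Uz hz]; rewrite exprS -mulrA hz mulr0.
by rewrite exprS -mulrA -xy.
Qed.

(** * Stable range and inverses in a finite dimensional unital algebra *)

Section Unital.
Variable P : B -> Prop.
Hypotheses (hP : nsubalg P) (P1 : P 1) (Ps : in_span s P).

(* Choose [t] so that [u P], with [u = a + b t], is maximal. If [u] were not
   left invertible, a nonzero element of [(1 - u u') P (1 - u' u)] could be
   used to enlarge [u P] by changing [t]. *)
Lemma fin_dim_stable_range1 (a y b z : B) : regular P ->
  P a -> P y -> P b -> P z -> a * y + b * z = 1 ->
  exists t v, P t /\ P v /\ (a + b * t) * v = 1 /\ v * (a + b * t) = 1.
Proof.
move=> regP Pa Py Pb Pz eq1; have [Pl PM] := hP.
pose C W := exists2 t, P t &
  forall x, W x <-> exists2 r, P r & x = (a + b * t) * r.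
have [W CW||W [[t Pt ht] maxW]] := @exists_maximal K B s C.
- have [t Pt ht] := CW.
  have Pu : P (a + b * t) by apply: lsubD => //; apply: PM.
  split; last by move=> x /ht [r Pr ->]; apply: Ps.2; apply: PM.
  split; first by apply/ht; exists 0; [case: Pl | rewrite mulr0].
  move=> k x x' /ht [r Pr ->] /ht [r' Pr' ->]; apply/ht.
  by exists (k *: r + r'); [apply: Pl.2 | rewrite mulrDr scalerAr].
- exists (fun x => exists2 r, P r & x = (a + b * 0) * r), 0 => //.
  by case: Pl.
set u := a + b * t in ht.
have Pu : P u by apply: lsubD => //; apply: PM.
have [u' Pu' uu'u] := regP u Pu.
set k := 1 - u' * u; set e := u * u'.
have Pk : P k by apply: lsubB => //; apply: PM.
have Pe : P e by apply: PM.
have P1e : P (1 - e) by apply: lsubB.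
have uk : u * k = 0 by rewrite mulrBr mulr1 mulrA uu'u subrr.
have kk : k * k = k by rewrite {1}/k mulrBl mul1r -mulrA uk mulr0 subr0.
have k1k : k * (1 - k) = 0 by rewrite mulrBr mulr1 kk subrr.
have u1k : u * (1 - k) = u by rewrite mulrBr mulr1 uk subr0.
have eu : (1 - e) * u = 0 by rewrite mulrBl mul1r uu'u subrr.
set z' := z - t * y.
have Pz' : P z' by apply: lsubB => //; apply: PM.
have eq1' : u * y + b * z' = 1.
  by rewrite /u /z' mulrDl mulrBr mulrA -addrA [b * t * y + _]addrC subrK.
have ebz : (1 - e) * (b * z') = 1 - e.
  have : (1 - e) * (u * y + b * z') = 1 - e by rewrite eq1' mulr1.
  by rewrite mulrDr mulrA eu mul0r add0r.
(* For [t' = t + z' r k] the element [a + b t'] gives [u] when multiplied by [1 - k] and [b z' r k]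
   when multiplied by [k]. By maximality [b z' r k] lies in [u P], which [1 - e] annihilates. *)
have ePk r : P r -> (1 - e) * r * k = 0.
  move=> Pr.
  have Pzrk : P (z' * r * k) by do ![apply: (PM) => //].
  have hsub : W (b * z' * r * k).
    pose t' := t + z' * r * k.
    have at' : a + b * t' = u + b * (z' * r * k) by rewrite /t' mulrDr addrA.
    apply: (maxW (fun x => exists2 r, P r & x = (a + b * t') * r)).
    - by exists t' => //; apply: lsubD.
    - move=> x /ht [q Pq ->]; exists ((1 - k) * q).
        by apply: PM => //; apply: lsubB.
      rewrite at'; have -> : (u + b * (z' * r * k)) * ((1 - k) * q) =
          u * (1 - k) * q + b * (z' * r) * (k * (1 - k)) * q.
        by rewrite [LHS]mulrDl !mulrA.
      by rewrite u1k k1k mulr0 mul0r addr0.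
    - exists k => //; rewrite at'.
      have -> : (u + b * (z' * r * k)) * k = u * k + b * z' * r * (k * k).
        by rewrite [LHS]mulrDl !mulrA.
      by rewrite uk kk add0r.
  have [q _ hq] := (ht _).1 hsub.
  have : (1 - e) * (b * z' * r * k) = 0 by rewrite hq mulrA eu mul0r.
  have -> : (1 - e) * (b * z' * r * k) = (1 - e) * (b * z') * r * k.
    by rewrite !mulrA.
  by rewrite ebz.
(* [I] is a left ideal containing [k], and [e = u u'] acts on it as the identity. So [u] maps [I]
   onto itself and is injective there; but [u k = 0]. *)
pose I x := P x /\ forall r, P r -> (1 - e) * r * x = 0.
have Is : in_span s I.
  split; last by move=> x [Px _]; apply: Ps.2.
  split; first by split=> [|r Pr]; [case: Pl | rewrite mulr0].
  move=> c x x' [Px hx] [Px' hx']; split=> [|r Pr]; first exact: Pl.2.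
  by rewrite mulrDr -scalerAr hx // hx' // scaler0 addr0.
have IM q x : P q -> I x -> I (q * x).
  move=> Pq [Px hx]; split=> [|r Pr]; first exact: PM.
  by rewrite mulrA -(mulrA _ r) hx //; apply: PM.
have k0 : k = 0.
  apply: (in_span_surj_inj Is _ _ _ uk); first by move=> x; apply: IM.
    move=> x Ix; exists (u' * x); first exact: IM.
    have /eqP := Ix.2 1 P1; rewrite mulr1 mulrBl mul1r subr_eq0 => /eqP.
    by rewrite mulrA.
  by split.
have u'u : u' * u = 1 by apply/eqP; rewrite eq_sym -subr_eq0 -/k k0.
have uu' : u * u' = 1.
  apply/eqP; rewrite eq_sym -subr_eq0; apply/eqP.
  apply: (@in_span_surj_inj P u') => //.
  - by move=> x; apply: PM.
  - by move=> x Px; exists (u * x); [apply: PM | rewrite mulrA u'u mul1r].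
  - by rewrite mulrBr mulr1 mulrA u'u mul1r subrr.
by exists t, u'.
Qed.

(** The descending chain [c^k K[c]] stabilizes, so [c^k = c^(k+1) p(c)] for some [p], and [c^k]
    cancels because [c] is invertible. *)
Lemma fin_dim_unit_poly (c v : B) : P c -> c * v = 1 -> v * c = 1 ->
  exists p : {poly K}, c * horner_alg c p = 1.
Proof.
move=> Pc cv vc; have [Pl PM] := hP.
have Pp p : P (horner_alg c p).
  elim/poly_ind: p => [|p a IHp]; first by rewrite rmorph0; case: Pl.
  rewrite rmorphD rmorphM /= horner_algX horner_algC.
  by apply: lsubD => //; [apply: PM | apply: lsubZ].
have Pck k : P (c ^+ k).
  by elim: k => [|k IHk]; rewrite ?expr0 // exprS; apply: PM.
pose C W := exists k, forall x, W x <-> exists p, x = c ^+ k * horner_alg c p.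
have [W CW||W [[k hk] minW]] := @exists_minimal K B s C.
- have [k hk] := CW; split; last by move=> x /hk [p ->]; apply: Ps.2; apply: PM.
  split; first by apply/hk; exists 0; rewrite rmorph0 mulr0.
  move=> a x y /hk [p ->] /hk [q ->]; apply/hk; exists (a *: p + q).
  by rewrite linearP /= mulrDr mulr_algl scalerAr.
- by exists (fun x => exists p, x = c ^+ 0 * horner_alg c p), 0.
have : W (c ^+ k) by apply/hk; exists 1; rewrite rmorph1 mulr1.
move/(minW (fun x => exists p, x = c ^+ k.+1 * horner_alg c p)) => [||p hp].
- by exists k.+1.
- move=> x [p ->]; apply/hk; exists ('X * p).
  by rewrite rmorphM /= horner_algX exprSr mulrA.
- have vck : v ^+ k * c ^+ k = 1.
    by rewrite -exprMn_comm ?vc ?expr1n // /GRing.comm cv vc.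
  exists p; have : v ^+ k * c ^+ k = v ^+ k * (c ^+ k.+1 * horner_alg c p).
    by rewrite -hp.
  by rewrite vck exprSr -!mulrA mulrA vck mul1r => ->.
Qed.

End Unital.

(** * Regularity of semiprime finite dimensional algebras *)

Section Semiprime.
Variable S : B -> Prop.
Hypotheses (hS : nsubalg S) (Ss : in_span s S).
Hypothesis semiprimeS : forall M : B -> Prop, lsub M ->
  (forall x, M x -> S x) -> (forall x y, M x -> S y -> M (x * y)) ->
  (forall x y, M x -> M y -> x * y = 0) -> forall x, M x -> x = 0.

Let right_ideal (I : B -> Prop) : Prop := lsub I /\ (forall x, I x -> S x) /\
  forall x y, I x -> S y -> I (x * y).

Let right_ideal_span I : right_ideal I -> in_span s I.
Proof. by move=> [Il [IS _]]; split=> // x /IS; apply: Ss.2. Qed.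

Let right_ideal_mull I m : right_ideal I -> S m ->
  right_ideal (fun x => exists2 y, I y & x = m * y).
Proof.
move=> [Il [IS IM]] Sm; split; last split.
- split; first by exists 0; [case: Il | rewrite mulr0].
  move=> a x y [x' Ix ->] [y' Iy ->]; exists (a *: x' + y'); first exact: Il.2.
  by rewrite mulrDr scalerAr.
- by move=> x [y Iy ->]; apply: hS.2 => //; apply: IS.
- by move=> x y [x' Ix ->] Sy; exists (x' * y); [apply: IM | rewrite mulrA].
Qed.

Let right_ideal_ann I m : right_ideal I ->
  right_ideal (fun x => I x /\ m * x = 0).
Proof.
move=> [Il [IS IM]]; split; last split.
- split; first by split; [case: Il | rewrite mulr0].
  move=> a x y [Ix hx] [Iy hy]; split; first exact: Il.2.
  by rewrite mulrDr -scalerAr hx hy scaler0 addr0.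
- by move=> x [/IS].
- by move=> x y [Ix hx] Sy; split; [apply: IM | rewrite mulrA hx mul0r].
Qed.

(** Brauer's lemma: if [m m'] is nonzero then, by minimality, left multiplication by [m] maps [M]
    onto itself with zero kernel; the solution [e] of [m = m e] is idempotent and generates [M]. *)
Let minimal_right_ideal_idem M : right_ideal M -> (exists2 m, M m & m <> 0) ->
  (forall M', right_ideal M' -> (forall x, M' x -> M x) ->
     (exists2 m, M' m & m <> 0) -> forall x, M x -> M' x) ->
  exists e, M e /\ e <> 0 /\ forall x, M x -> e * x = x.
Proof.
move=> rM [m0 Mm0 m0n] minM; have [Ml [MS MM]] := rM.
have [m [m' [Mm [Mm' mm'n]]]] : exists m m', M m /\ M m' /\ m * m' <> 0.
  apply: NNPP => hn; apply: m0n; apply: (semiprimeS Ml MS MM) => // x y Mx My.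
  by apply: NNPP => hxy; apply: hn; exists x, y.
have mM := minM _ (right_ideal_mull rM (MS _ Mm)).
have {mM} mM x : M x -> exists2 y, M y & x = m * y.
  apply: mM; first by move=> _ [y My ->]; apply: MM => //; apply: MS.
  by exists (m * m') => //; exists m'.
have m_inj x : M x -> m * x = 0 -> x = 0.
  move=> Mx mx0; apply: NNPP => xn.
  have [||_] := minM _ (right_ideal_ann m rM) _ _ m' Mm'.
  - by move=> y [].
  - by exists x.
  - exact: mm'n.
have [e Me me] := mM m Mm.
have ee : e * e = e.
  apply/eqP; rewrite -subr_eq0; apply/eqP; apply: m_inj.
    by apply: lsubB => //; apply: MM => //; apply: MS.
  by rewrite mulrBr mulrA -me -me subrr.
have en : e <> 0 by move=> e0; apply: mm'n; rewrite me e0 mulr0 mul0r.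
exists e; split=> //; split=> // x Mx.
have [||y _ ->] := minM _ (right_ideal_mull rM (MS _ Me)) _ _ x Mx.
- by move=> _ [y My ->]; apply: MM => //; apply: MS.
- by exists e => //; exists e.
- by rewrite mulrA ee.
Qed.

(** A minimal counterexample [I] contains a minimal right ideal with left unit [e]. The elements of
    [I] killed by [e] from the left form a right ideal omitting [e], so it has a left unit [f].
    Since it contains each [x - e x], the join of [e] and [f] is a left unit for [I]. *)
Let right_ideal_left_unit I : right_ideal I ->
  exists2 g, I g & forall x, I x -> g * x = x.
Proof.
move=> rI; apply: NNPP => hI.
pose C I := right_ideal I /\ ~ exists2 g, I g & forall x, I x -> g * x = x.
have [||{}I [[{}rI {}hI] minI]] := @exists_minimal K B s C.
- by move=> U [/right_ideal_span].
- by exists I.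
have [Il [IS IM]] := rI.
have In : exists2 x, I x & x <> 0.
  apply: NNPP => hn; apply: hI; exists 0; first by case: Il.
  move=> x Ix; rewrite mul0r; apply: NNPP => x0; apply: hn.
  by exists x => // /esym.
pose D M := right_ideal M /\ (forall x, M x -> I x) /\ exists2 m, M m & m <> 0.
have [||M [[rM [MI Mn]] minM]] := @exists_minimal K B s D.
- by move=> U [/right_ideal_span].
- by exists I.
have [|e [Me [en he]]] := minimal_right_ideal_idem rM Mn.
  move=> M' rM' M'M M'n; apply: minM => //; split=> //; split=> // x /M'M.
  exact: MI.
have Ie := MI _ Me; have ee := he _ Me.
have [f [If ef] hf] : exists2 f, I f /\ e * f = 0 &
    forall x, I x /\ e * x = 0 -> f * x = x.
  apply: NNPP => hn; have [||_] := minI (fun x => I x /\ e * x = 0) _ _ e Ie.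
  - by split; [apply: right_ideal_ann | exact: hn].
  - by move=> x [].
  - by rewrite ee.
apply: hI; exists (e + f - f * e).
  by apply: lsubB; [|apply: lsubD|apply: IM => //; apply: IS].
move=> x Ix.
have -> : (e + f - f * e) * x = e * x + f * (x - e * x).
  by rewrite mulrBl mulrDl mulrBr addrA mulrA.
rewrite hf; first by rewrite addrC subrK.
split; last by rewrite mulrBr mulrA ee subrr.
by apply: lsubB => //; apply: IM => //; apply: IS.
Qed.

(** Without an identity in [S], the right ideal generated by [x] is [K x + x S]. Its left unit
    [g = a x + x r] is idempotent, so [g = x (a g + r g)], and [g x = x]. *)
Lemma semiprime_fin_dim_regular : regular S.
Proof.
move=> x Sx; have [Sl SM] := hS.
have [|g [a [r [Sr gE]]] hg] :=
    @right_ideal_left_unit (fun z => exists a r, S r /\ z = a *: x + x * r).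
  split; last split.
  - split; first by exists 0, 0; rewrite scale0r mulr0 addr0; case: Sl.
    move=> c _ _ [a [r [Sr ->]]] [a' [r' [Sr' ->]]].
    exists (c * a + a'), (c *: r + r'); split; first exact: Sl.2.
    by rewrite scalerDr scalerDl mulrDr scalerA -scalerAr addrACA.
  - move=> _ [a [r [Sr ->]]]; apply: Sl.2 => //; exact: SM.
  - move=> _ y [a [r [Sr ->]]] Sy; exists 0, (a *: y + r * y).
    split; first by apply: Sl.2 => //; apply: SM.
    by rewrite scale0r add0r mulrDl mulrDr -scalerAl scalerAr mulrA.
have gg : g * g = g by apply: hg; exists a, r.
have gx : g * x = x.
  apply: hg; exists 1, 0; rewrite scale1r mulr0 addr0; split=> //.
  by case: Sl.
have Sg : S g by rewrite gE; apply: Sl.2 => //; apply: SM.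
exists (a *: g + r * g); first by apply: Sl.2 => //; apply: SM.
have -> : x * (a *: g + r * g) = g.
  by rewrite -[RHS]gg {3}gE mulrDr mulrDl mulrA -scalerAl scalerAr.
exact: gx.
Qed.

End Semiprime.
End FiniteDimensional.

(** * Lifting along a surjection with locally unit-regular kernel *)

Section Extensions.
Variables (K : fieldType) (T B : algType K) (F : {lrmorphism T -> B}).
Hypothesis F_surj : forall b, exists t, F t = b.
Hypothesis ker_unit_regular : forall l : seq T,
  (forall x, x \in l -> F x = 0) ->
  exists S : T -> Prop, (forall x, S x -> F x = 0) /\
    (forall x, x \in l -> S x) /\ unit_regular S.

Lemma ker_regular : regular (fun x => F x = 0).
Proof.
move=> x Fx.
have [|S [SF [Sx [_ [e [_ [_ reg]]]]]]] := @ker_unit_regular [:: x].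
  by move=> y; rewrite inE => /eqP ->.
have [|u [_ [Su [_ [_ [_ xux]]]]]] := reg x; first by apply: Sx; rewrite inE.
by exists u => //; apply: SF.
Qed.

Lemma preim_regular (S : B -> Prop) : regular S -> regular (fun x => S (F x)).
Proof.
move=> regS x Sx; have [y' Sy' hy'] := regS _ Sx; have [y Fy] := F_surj y'.
have [|z Fz hz] := @ker_regular (x - x * y * x).
  by rewrite rmorphB !rmorphM /= Fy hy' subrr.
exists (y + (1 - y * x) * z * (1 - x * y)); last exact: regular_correction.
by rewrite rmorphD !rmorphM /= Fz mulr0 mul0r addr0 Fy.
Qed.

Lemma map_horner_alg c p : F (horner_alg c p) = horner_alg (F c) p.
Proof.
elim/poly_ind: p => [|p a IHp]; first by rewrite !rmorph0.
rewrite !rmorphD !rmorphM /= !horner_algX !horner_algC IHp.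
by rewrite linearZ /= rmorph1.
Qed.

Variables (s : seq B) (P : B -> Prop).
Hypotheses (hP : nsubalg P) (P1 : P 1) (Ps : in_span s P) (regP : regular P).

(* The inverse of [F c] is a polynomial in [F c], so [c] has an inverse [q]
   modulo the kernel that commutes with [c]; hence [c] and [q] preserve the
   right annihilator [(1 - h) T] of [1 - c q]. *)
Lemma unit_lift (c : T) (v : B) : P (F c) -> F c * v = 1 -> v * F c = 1 ->
  exists u u', u * u' = 1 /\ u' * u = 1 /\ F u = F c /\ F u' = v.
Proof.
move=> Pc cv vc; have [p hp] := fin_dim_unit_poly hP P1 Ps Pc cv vc.
pose q := horner_alg c p.
have cq : c * q = q * c.
  have := congr1 (horner_alg c) (mulrC 'X p).
  by rewrite !rmorphM /= horner_algX.
have Fq : F q = v.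
  by rewrite map_horner_alg -[LHS]mul1r -vc -mulrA hp mulr1.
clearbody q; pose a := 1 - c * q.
have Fa : F a = 0 by rewrite rmorphB rmorphM rmorph1 /= Fq cv subrr.
have [a' Fa' aa'a] := ker_regular Fa.
have ca : c * a = a * c.
  by rewrite /a mulrBr mulrBl mulr1 mul1r -mulrA -cq.
have qa : q * a = a * q.
  by rewrite /a mulrBr mulrBl mulr1 mul1r mulrA -cq.
pose h := a' * a; pose k := 1 - h.
have Fh : F h = 0 by rewrite rmorphM /= Fa mulr0.
have ak : a * k = 0 by rewrite mulrBr mulr1 mulrA aa'a subrr.
have hck : h * (c * k) = 0.
  by rewrite /h -mulrA (mulrA a c) -ca -mulrA ak !mulr0.
have hqk : h * (q * k) = 0.
  by rewrite /h -mulrA (mulrA a q) -qa -mulrA ak !mulr0.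
have hh : h * h = h by rewrite /h -mulrA (mulrA a) aa'a.
have kh : k * h = 0 by rewrite mulrBl mul1r hh subrr.
have kck : k * (c * k) = c * k by rewrite mulrBl mul1r hck subr0.
have kqk : k * (q * k) = q * k by rewrite mulrBl mul1r hqk subr0.
have cqk : c * q * k = k.
  by apply/eqP; rewrite eq_sym -subr_eq0 -{1}[k]mul1r -mulrBl -/a ak.
have hk1 : h + k = 1 by rewrite /k addrC subrK.
have Fk : F k = 1 by rewrite rmorphB rmorph1 /= Fh subr0.
clearbody h k.
(* On [k T] the elements [c] and [q] are mutually inverse because [a k = 0]; the summand [h]
   restores the identity on the complement and vanishes under [F]. *)
exists (h + c * k), (h + q * k); split; [|split; [|split]].
- rewrite mulrDl !mulrDr hh hqk addr0 -!mulrA kh mulr0 add0r kqk.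
  by rewrite mulrA cqk.
- rewrite mulrDl !mulrDr hh hck addr0 -!mulrA kh mulr0 add0r kck.
  by rewrite mulrA -cq cqk.
- by rewrite rmorphD rmorphM /= Fh Fk add0r mulr1.
- by rewrite rmorphD rmorphM /= Fh Fk add0r mulr1.
Qed.

(* First solve the problem modulo the kernel, lift the resulting unit, divide
   by it to land in [1 + ker F], and solve the remaining problem inside a
   unit-regular subalgebra of the kernel. *)
Lemma preim_stable_range1 (x y : T) : P (F x) -> P (F y) -> x * y * x = x ->
  exists t v, P (F t) /\ P (F v) /\
    (x + (1 - x * y) * t) * v = 1 /\ v * (x + (1 - x * y) * t) = 1.
Proof.
move=> Px Py xyx; have [Pl PM] := hP; set b := 1 - x * y.
have Pb : P (F b).
  by rewrite rmorphB rmorphM rmorph1; apply: lsubB => //; apply: PM.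
have [|t0 [v0 [Pt0 [Pv0 [cv vc]]]]] :=
    fin_dim_stable_range1 hP P1 Ps (y := F y) (z := 1) regP Px Py Pb P1.
  by rewrite mulr1 -rmorphM -rmorphD /= /b addrC subrK rmorph1.
have [t Ft] := F_surj t0; pose c := x + b * t.
have Fc : F c = F x + F b * t0 by rewrite rmorphD rmorphM /= Ft.
have [|||u [v [uv [vu [Fu Fv]]]]] := @unit_lift c v0; rewrite ?Fc //.
  by apply: lsubD => //; apply: PM.
(* Now [c = (1 + j) u] with [j] in the kernel. The element [m] lies in [b T] and satisfies
   [(e + j) (e - y1 j) + m = e] for the identity [e] of any subalgebra holding [j], [y1 j] and
   [m]. *)
pose j := c * v - 1; pose y1 := u * y; pose z1 := 1 - t * y.
pose m := - (b * z1 * j).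
have Fj : F j = 0 by rewrite rmorphB rmorphM rmorph1 /= Fv Fc cv subrr.
have cE : c = (1 + j) * u by rewrite /j addrC subrK -mulrA vu mulr1.
have cyb : c * y + b * z1 = 1.
  rewrite /z1 /c mulrDl mulrBr mulr1 mulrA -addrA [b * t * y + _]addrC subrK.
  by rewrite /b addrC subrK.
have mE : m = y1 * j + j * y1 * j - j.
  have -> : y1 * j + j * y1 * j = (1 + j) * u * y * j.
    by rewrite -(mulrA (1 + j)) -/y1 [(1 + j) * _]mulrDl mul1r [RHS]mulrDl.
  rewrite -cE -[X in _ - X]mul1r -mulrBl /m -mulNr; congr (_ * j).
  by rewrite -cyb opprD addrA subrr add0r.
have mD : m = - (b * z1 * j) by [].
have Fm : F m = 0 by rewrite rmorphN rmorphM /= Fj mulr0 oppr0.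
have cD : c = x + b * t by [].
clearbody m y1 z1 j c b.
have [|S [SF [Sl urS]]] :=
    @ker_unit_regular [:: j; y1 * j; m].
  move=> z; rewrite !inE => /or3P [] /eqP -> //.
  by rewrite rmorphM /= Fj mulr0.
have [[Slin SM] _] := urS.
have [e [Se [idS sr1]]] := unit_regular_stable_range1 urS.
have Sj : S j by apply: Sl; rewrite inE eqxx.
have Sy : S (y1 * j) by apply: Sl; rewrite !inE eqxx orbT.
have Sm : S m by apply: Sl; rewrite !inE eqxx !orbT.
have Sal : S (e + j) by apply: lsubD.
have Sbe : S (e - y1 * j) by apply: lsubB.
have [|tau [w [Stau [Sw [hw wh]]]]] := sr1 _ _ _ Sal Sbe Sm.
  suff -> : (e + j) * (e - y1 * j) = e - m by rewrite subrK.
  rewrite mulrDl !mulrBr (idS _ Se).1 (idS _ Sy).1 (idS _ Sj).2 mulrA mE.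
  by rewrite !opprD opprK -!addrA; do 2!congr (_ + _); rewrite addrC.
(* Adding [1 - e] turns units of [S] into units of [T]. *)
have unit_ext p q : S p -> S q -> p * q = e -> (1 - e + p) * (1 - e + q) = 1.
  move=> Sp Sq pq.
  have kk : (1 - e) * (1 - e) = 1 - e.
    by rewrite mulrBr mulr1 mulrBl mul1r (idS _ Se).1 subrr subr0.
  have kq : (1 - e) * q = 0 by rewrite mulrBl mul1r (idS _ Sq).1 subrr.
  have pk : p * (1 - e) = 0 by rewrite mulrBr mulr1 (idS _ Sp).2 subrr.
  have := subrK e 1; move: (1 - e) kk kq pk => k kk kq pk ke.
  by rewrite mulrDl !mulrDr kk kq pk pq addr0 add0r.
have Som : S (e + j + m * tau) by apply: lsubD => //; apply: SM.
have w12 := unit_ext _ _ Som Sw hw; have w21 := unit_ext _ _ Sw Som wh.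
(* As [m = - b z1 j], the term [m tau u] is absorbed into [b t']; and [F t' = F t] because
   [F j = 0]. *)
pose t' := t - z1 * j * tau * u.
have uE : x + b * t' = (1 - e + (e + j + m * tau)) * u.
  have -> : 1 - e + (e + j + m * tau) = 1 + j + m * tau.
    by rewrite !addrA subrK.
  by rewrite [RHS]mulrDl -cE mD cD !mulNr mulrBr !mulrA addrA.
exists t', (v * (1 - e + w)); rewrite uE; split; [|split; [|split]].
- by rewrite rmorphB !rmorphM /= Fj mulr0 !mul0r subr0 Ft.
- rewrite rmorphM rmorphD rmorphB rmorph1 /= (SF _ Se) (SF _ Sw).
  by rewrite subr0 addr0 mulr1 Fv.
- by rewrite mulrA -(mulrA _ u) uv mulr1.
- by rewrite mulrA -(mulrA v) w21 mulr1.
Qed.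
End Extensions.

(** * Compressing units to a corner *)

Lemma corner_mul (B : pzRingType) (g k x y : B) : g * g = g -> g + k = 1 ->
  x * g = x -> g * y = y -> (x + k) * (y + k) = x * y + k.
Proof.
move=> gg gk1 xg gy; have kE : k = 1 - g by rewrite -gk1 [g + k]addrC addrK.
have kk : k * k = k.
  by rewrite {1}kE mulrBl mul1r kE mulrBr mulr1 gg subrr subr0.
have xk : x * k = 0 by rewrite kE mulrBr mulr1 xg subrr.
have ky : k * y = 0 by rewrite kE mulrBl mul1r gy subrr.
by rewrite mulrDl !mulrDr xk ky kk addr0 add0r.
Qed.

(** Since [1 - (x + k) (y + k) = g - x y] lies in the corner, [k u = k] and [k v = k]: both are
    block triangular for [g + k = 1], so compression by [g] keeps them inverse. From
    [x y (g - x y) = 0] follows [x y u g = x], whence [x (g v g) x = x y x]. *)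
Lemma corner_unit (B : pzRingType) (g k x y t u v : B) :
  g * g = g -> g + k = 1 ->
  g * x = x -> x * g = x -> g * y = y -> y * g = y -> x * y * x = x ->
  u = x + k + (1 - (x + k) * (y + k)) * t -> u * v = 1 -> v * u = 1 ->
  [/\ (g * u * g) * (g * v * g) = g, (g * v * g) * (g * u * g) = g &
      x * (g * v * g) * x = x].
Proof.
move=> gg gk1 gx xg gy yg xyx uD uv vu.
have kE : k = 1 - g by rewrite -gk1 [g + k]addrC addrK.
have gE : g = 1 - k by rewrite -gk1 addrK.
have gk : g * k = 0 by rewrite kE mulrBr mulr1 gg subrr.
have kg : k * g = 0 by rewrite kE mulrBl mul1r gg subrr.
have kk : k * k = k by rewrite {1}kE mulrBl mul1r gk subr0.
have kx : k * x = 0 by rewrite kE mulrBl mul1r gx subrr.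
have yk : y * k = 0 by rewrite kE mulrBr mulr1 yg subrr.
have bE : 1 - (x + k) * (y + k) = g - x * y.
  by rewrite (corner_mul gg) // opprD addrCA -gE addrC.
have uE : u = x + k + (g - x * y) * t by rewrite uD bE.
have ku : k * u = k.
  rewrite uE !mulrDr kx kk add0r mulrA mulrBr kg mulrA kx mul0r subr0 mul0r.
  by rewrite addr0.
have kv : k * v = k by rewrite -{1}ku -mulrA uv mulr1.
have xyu : x * y * u * g = x.
  have -> : x * y * u * g = x * y * x * g + x * (y * k) * g +
      x * y * (g - x * y) * t * g.
    by rewrite uE; move: (g - x * y) => d; rewrite !mulrDr !mulrDl !mulrA.
  have -> : x * y * (g - x * y) = 0.
    by rewrite mulrBr !mulrA xyx -!mulrA yg subrr.
  by rewrite xyx yk mulr0 !mul0r !addr0.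
have uv' : (g * u * g) * (g * v * g) = g.
  have -> : g * u * g * (g * v * g) = g * u * (g * g) * v * g by rewrite !mulrA.
  rewrite gg {2}gE mulrBr mulr1 mulrBl mulrBl -[_ * k * v]mulrA kv.
  by rewrite -[_ * k * g]mulrA kg mulr0 subr0 -[_ * u * v]mulrA uv mulr1.
split=> //.
  have -> : g * v * g * (g * u * g) = g * v * (g * g) * u * g by rewrite !mulrA.
  rewrite gg {2}gE mulrBr mulr1 mulrBl mulrBl -[_ * k * u]mulrA ku.
  by rewrite -[_ * k * g]mulrA kg mulr0 subr0 -[_ * v * u]mulrA vu mulr1.
rewrite -{1}xyu -{1}yg.
have -> : x * (y * g) * u * g * (g * v * g) * x =
    x * y * ((g * u * g) * (g * v * g)) * x by rewrite !mulrA.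
by rewrite uv' -!mulrA gx mulrA.
Qed.

(** * The unitization of a non-unital algebra *)

Section NalgTheory.
Variables (K : fieldType) (R : nalg K).

Lemma nmul0l x : nmul R 0 x = 0.
Proof. by rewrite -(scale0r (0 : R)) nmulZl !scale0r. Qed.

Lemma nmul0r x : nmul R x 0 = 0.
Proof. by rewrite -(scale0r (0 : R)) nmulZr !scale0r. Qed.

(** The pair [(a, x)] stands for [a + x], with [a] a multiple of the adjoined identity. *)
Definition unitization : Type := (K^o * R)%type.
HB.instance Definition _ := GRing.Lmodule.copy unitization (K^o * R)%type.

Definition unitization_mul (z w : unitization) : unitization :=
  (z.1 * w.1, z.1 *: w.2 + w.1 *: z.2 + nmul R z.2 w.2).

Fact unitization_mulA : associative unitization_mul.
Proof.
move=> [a x] [b y] [c z]; congr pair => /=; first by rewrite mulrA.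
rewrite !scalerDr !nmulDl !nmulDr !nmulZl !nmulZr !scalerA nmulA.
rewrite [c * a]mulrC [c * b]mulrC -!addrA; congr (_ + (_ + _)).
rewrite [LHS]addrCA; congr (_ + _).
by rewrite [RHS]addrCA; congr (_ + _); rewrite addrCA.
Qed.

Fact unitization_mul1 : left_id ((1, 0) : unitization) unitization_mul.
Proof.
move=> [a x]; congr pair => /=; first by rewrite mul1r.
by rewrite scale1r scaler0 nmul0l !addr0.
Qed.

Fact unitization_mulr1 : right_id ((1, 0) : unitization) unitization_mul.
Proof.
move=> [a x]; congr pair => /=; first by rewrite mulr1.
by rewrite scale1r scaler0 nmul0r add0r addr0.
Qed.

Fact unitization_mulDl : left_distributive unitization_mul +%R.
Proof.
move=> [a x] [b y] [c z]; congr pair => /=; first by rewrite mulrDl.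
rewrite scalerDl scalerDr nmulDl [RHS]addrACA.
by congr (_ + _); rewrite addrACA.
Qed.

Fact unitization_mulDr : right_distributive unitization_mul +%R.
Proof.
move=> [a x] [b y] [c z]; congr pair => /=; first by rewrite mulrDr.
rewrite scalerDl scalerDr nmulDr [RHS]addrACA.
by congr (_ + _); rewrite addrACA.
Qed.

Fact unitization_1_neq0 : ((1, 0) : unitization) != 0.
Proof. by apply/eqP => -[/eqP]; rewrite oner_eq0. Qed.

HB.instance Definition _ := GRing.Zmodule_isNzRing.Build unitization
  unitization_mulA unitization_mul1 unitization_mulr1 unitization_mulDl
  unitization_mulDr unitization_1_neq0.

Fact unitization_scaleAl (a : K) (z w : unitization) :
  a *: (z * w) = (a *: z) * w.
Proof.
case: z w => [b x] [c y].
have sE (p q : K^o) : p *: q = p * q by [].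
congr pair => /=; first by rewrite !sE mulrA.
by rewrite sE !scalerDr !scalerA nmulZl [c * a]mulrC.
Qed.

HB.instance Definition _ :=
  GRing.Lmodule_isLalgebra.Build K unitization unitization_scaleAl.

Fact unitization_scaleAr (a : K) (z w : unitization) :
  a *: (z * w) = z * (a *: w).
Proof.
case: z w => [b x] [c y].
have sE (p q : K^o) : p *: q = p * q by [].
congr pair => /=; first by rewrite !sE mulrCA.
by rewrite !scalerDr !scalerA nmulZr [b * a]mulrC.
Qed.

HB.instance Definition _ :=
  GRing.Lalgebra_isAlgebra.Build K unitization unitization_scaleAr.

Definition uin (x : R) : unitization := (0, x).

Definition uset (S : R -> Prop) (z : unitization) : Prop := z.1 = 0 /\ S z.2.

Lemma uinE z : z.1 = 0 -> z = uin z.2.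
Proof. by case: z => a x /= ->. Qed.

Lemma uin_inj : injective uin.
Proof. by move=> x y []. Qed.

Lemma uin_mul x y : uin x * uin y = uin (nmul R x y).
Proof. by congr pair => /=; rewrite ?mul0r // !scale0r !add0r. Qed.

Lemma uin_lin a x y : a *: uin x + uin y = uin (a *: x + y).
Proof. by congr pair => /=; rewrite addr0 scaler0. Qed.

Lemma uset_uin S x : S x -> uset S (uin x). Proof. by []. Qed.

Lemma uset_nsubalg S : subalg S -> nsubalg (uset S).
Proof.
move=> [[S0 Slin] SM]; split; first split.
- by split.
- move=> a z w [/uinE -> Sz] [/uinE -> Sw]; rewrite uin_lin.
  by apply: uset_uin; apply: Slin.
- move=> z w [/uinE -> Sz] [/uinE -> Sw]; rewrite uin_mul.
  by apply: uset_uin; apply: SM.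
Qed.

Lemma uset_unit_regular S : unit_regular_subalg S -> unit_regular (uset S).
Proof.
move=> [Ssub [e [Se [ide reg]]]]; split; first exact: uset_nsubalg.
exists (uin e); split=> //; split.
  by move=> z [/uinE -> /= /ide [h1 h2]]; rewrite !uin_mul h1 h2.
move=> z [/uinE -> /= /reg [u [v [Su [Sv [uv [vu zuz]]]]]]].
by exists (uin u), (uin v); rewrite !uin_mul uv vu zuz.
Qed.

(** This is [K + S]: the scalar coordinate is unrestricted. *)
Definition scalar_add (S : R -> Prop) (z : unitization) : Prop := S z.2.

Lemma scalar_add_nsubalg S : subalg S -> nsubalg (scalar_add S).
Proof.
move=> [[S0 Slin] SM]; split; first by split=> // a x y; apply: Slin.
move=> x y Sx Sy; rewrite /scalar_add /= -addrA.
by apply: (Slin) => //; apply: (Slin) => //; apply: SM.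
Qed.

(** * Finite dimensional semisimple subalgebras in the unitization *)

Section FdSemisimple.
Variable S : R -> Prop.
Hypothesis fdssS : fdss_subalg S.

Lemma fdss_in_span : exists s, in_span s (scalar_add S).
Proof.
have [[[S0 Slin] SM] [[s [sS hs]] _]] := fdssS.
exists (1 :: map uin s); split; first by split=> // a x y; apply: Slin.
move=> [a x] /= /hs [c xE]; rewrite /lspan /= size_map.
(* The default [a] is the coefficient of the leading generator [1]; the shifted indices carry the
   coefficients of [x]. *)
exists (fun i => oapp c a (unlift ord0 i)).
rewrite big_ord_recl /= unlift_none /=.
under eq_bigr => i _ do rewrite liftK /= (nth_map 0 _ _ (ltn_ord i)).
have -> : \sum_(i < size s) c i *: uin s`_i =
    uin (\sum_(i < size s) c i *: s`_i).
  elim/big_rec2: _ => [//|i u v _ ->]; exact: uin_lin.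
rewrite -xE; congr pair => /=; first by rewrite addr0 /GRing.scale /= mulr1.
by rewrite scaler0 add0r.
Qed.

(* If [M] is a right ideal with [M M = 0], then the elements [x] of its right
   annihilator [L] such that [x L = 0] form an ideal of square zero
   containing [M]. *)
Lemma fdss_regular : regular (uset S).
Proof.
have [s [_ hs]] := fdss_in_span.
have [Ssub [_ ssS]] := fdssS; have [[S0 Slin] SM] := Ssub.
have uS := uset_nsubalg Ssub.
apply: (@semiprime_fin_dim_regular K unitization s) => //.
  by split; [case: uS | move=> z [_ /hs]].
move=> M [M0 Mlin] MS MSM MM z Mz.
rewrite (uinE (MS _ Mz).1); congr uin.
pose m x := M (uin x).
have mS x : m x -> S x by move/MS => [].
pose L x := S x /\ forall y, m y -> nmul R y x = 0.
pose I x := L x /\ forall y, L y -> nmul R x y = 0.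
have mL x : m x -> L x.
  move=> mx; split=> [|y my]; first exact: mS.
  by apply: uin_inj; rewrite -uin_mul; apply: MM.
apply: (ssS I).
- split; first by move=> x [[]].
  split; first split.
  + split; first by split=> // y _; rewrite nmul0r.
    by move=> y _; rewrite nmul0l.
  + move=> a x y [[Sx Lx] Ix] [[Sy Ly] Iy]; split; first split.
    * exact: Slin.
    * by move=> w mw; rewrite nmulDr nmulZr Lx // Ly // scaler0 addr0.
    * by move=> w Lw; rewrite nmulDl nmulZl Ix // Iy // scaler0 addr0.
  + have Lmul s0 x : S s0 -> L x -> L (nmul R s0 x).
      move=> Ss [Sx Lx]; split=> [|y my]; first exact: SM.
      rewrite nmulA Lx // /m -uin_mul; apply: MSM => //.
    move=> s0 x Ss [Lx Ix]; split; split.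
    * exact: Lmul.
    * by move=> y Ly; rewrite -nmulA Ix // nmul0r.
    * split=> [|y my]; first by apply: SM => //; case: Lx.
      by rewrite nmulA Lx.2 // nmul0l.
    * by move=> y Ly; rewrite -nmulA Ix //; apply: Lmul.
(* The exponent in [nilpotent] counts the factors after the first, so [1] means that products of two
   elements vanish. *)
- exists 1 => x [|y []] // _ Ix hy /=; apply: Ix.2.
  by have [] := hy y; rewrite ?inE.
- have mz : m z.2 by rewrite /m -(uinE (MS _ Mz).1).
  split; first exact: mL.
  by move=> y [_]; apply.
Qed.

(** When [z.1] is nonzero, its inverse is a quasi-inverse of [z] modulo [S]; the defect has scalar
    coordinate 0, so it is regular in [S] and [regular_correction] applies. *)
Lemma fdss_scalar_add_regular : regular (scalar_add S).
Proof.
move=> z Sz; have [Ssub _] := fdssS.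
have [z0|z0] := eqVneq z.1 0.
  by have [//|y [_ Sy] hy] := @fdss_regular z; exists y.
have [Al AM] := scalar_add_nsubalg Ssub.
have A1 : scalar_add S 1 by case: Ssub => -[].
pose y : unitization := (z.1^-1, 0).
have Ay : scalar_add S y by [].
have [|w [_ Aw] hw] := @fdss_regular (z - z * y * z).
  split; first by rewrite /= mulfV // mul1r subrr.
  by apply: (lsubB Al) => //; do 2!apply: (AM) => //.
exists (y + (1 - y * z) * w * (1 - z * y)); last exact: regular_correction.
apply: lsubD => //; apply: (AM); first (apply: (AM) => //).
  by apply: lsubB => //; apply: AM.
by apply: lsubB => //; apply: AM.
Qed.

End FdSemisimple.
End NalgTheory.

(** * Functoriality of the unitization *)

Section UnitizationMap.
Variables (K : fieldType) (R Q : nalg K) (f : R -> Q).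
Hypothesis hf : nhom f.

Definition umap of nhom f := fun z : unitization R =>
  ((z.1, f z.2) : unitization Q).

Lemma nhom0 : f 0 = 0.
Proof. by have := hf.1 (-1) 0 0; rewrite addr0 scaler0 scaleN1r addNr. Qed.

Lemma nhomD x y : f (x + y) = f x + f y.
Proof. by have := hf.1 1 x y; rewrite !scale1r. Qed.

Lemma nhomZ a x : f (a *: x) = a *: f x.
Proof. by have := hf.1 a x 0; rewrite nhom0 !addr0. Qed.

Fact umap_linear : linear (umap hf).
Proof. by move=> a z w; congr pair => /=; rewrite hf.1. Qed.

HB.instance Definition _ := GRing.isLinear.Build K (unitization R)
  (unitization Q) _ (umap hf) umap_linear.

Fact umap_monoid_morphism : monoid_morphism (umap hf).
Proof.
split; first by congr pair => /=; rewrite nhom0.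
by move=> z w; congr pair => /=; rewrite !nhomD !nhomZ hf.2.
Qed.

HB.instance Definition _ := GRing.isMonoidMorphism.Build (unitization R)
  (unitization Q) (umap hf) umap_monoid_morphism.

End UnitizationMap.

(** * Local unit-regularity of extensions *)

Lemma preim_nsubalg (K : fieldType) (T B : algType K) (F : {lrmorphism T -> B})
    (S : B -> Prop) : nsubalg S -> nsubalg (fun x => S (F x)).
Proof.
move=> [[S0 Slin] SM]; split; first split.
- by rewrite rmorph0.
- by move=> a x y Sx Sy; rewrite linearP; apply: Slin.
- by move=> x y Sx Sy; rewrite rmorphM; apply: SM.
Qed.

Lemma extension_loc_unit_regular (K : fieldType) (R Q : nalg K) (J : R -> Prop)
    (f : R -> Q) :
  nhom f -> (forall q, exists r, f r = q) -> (forall r, f r = 0 <-> J r) ->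
  loc_unit_regular J -> loc_fdss (fun _ : Q => True) ->
  loc_unit_regular (fun _ : R => True).
Proof.
move=> hf f_surj kerf urJ fdssQ E _.
have [//|S [_ [ES fdssS]]] := fdssQ (map f E).
pose F : {lrmorphism unitization R -> unitization Q} := umap hf.
have F_surj b : exists t, F t = b.
  case: b => a q; have [r <-] := f_surj q; by exists (a, r).
have kerF z : F z = 0 <-> uset J z.
  split=> [[z1 /kerf Jz]|[z1 /kerf Jz]]; first by [].
  by congr pair.
have F_ur (l : seq (unitization R)) : (forall x, x \in l -> F x = 0) ->
    exists S : unitization R -> Prop, (forall x, S x -> F x = 0) /\
      (forall x, x \in l -> S x) /\ unit_regular S.
  move=> hl; have [|S0 [S0J [lS0 urS0]]] := urJ (map snd l).
    by move=> _ /mapP [z /hl /kerF [_ Jz] ->].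
  exists (uset S0); split; first by move=> z [z1 /S0J Jz]; apply/kerF.
  split; last exact: uset_unit_regular.
  by move=> z zl; split; [case/kerF: (hl z zl) | apply/lS0/map_f].
have [Ssub _] := fdssS.
have [s Ps] := fdss_in_span fdssS.
have regP := fdss_scalar_add_regular fdssS.
have hP := scalar_add_nsubalg Ssub.
have P1 : scalar_add S 1 by case: Ssub => -[].
have regW := preim_regular F_surj F_ur (fdss_regular fdssS).
have hW := preim_nsubalg F (uset_nsubalg Ssub).
have hA := preim_nsubalg F hP.
have [|g [[g1 Sg] [gg hg]]] :=
    two_sided_unit_idem hW regW (F := map (@uin K R) E).
  by move=> _ /mapP [x xE ->]; split=> //; apply/ES/map_f.
have gE : g = uin g.2 by apply: uinE.
(* As [g] has scalar coordinate 0, compression by [g] sends [K + R0] into [R0]. *)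
have WgAg z : scalar_add S (F z) -> uset S (F (g * z * g)).
  move=> Az; split; first by rewrite /= [g.1]g1 mulr0.
  by apply: (hA.2 (g * z) g) => //; apply: (hA.2 g z).
pose C r := S (f r) /\ nmul R g.2 r = r /\ nmul R r g.2 = r.
have CP r : C r <-> S (f r) /\ g * uin r = uin r /\ uin r * g = uin r.
  rewrite gE !uin_mul; split=> -[Sr [h1 h2]]; split=> //.
    by rewrite h1 h2.
  by split; apply: uin_inj.
have C_corner z : scalar_add S (F z) ->
    exists2 r, C r & g * z * g = uin r.
  move=> Az; have [h1 h2] := WgAg z Az.
  have zE := uinE (h1 : (g * z * g).1 = 0).
  exists (g * z * g).2 => //; apply/CP; rewrite -zE; split=> //.
  by rewrite !mulrA gg -!mulrA gg.
exists C; split=> //; split.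
  move=> x xE; apply/CP; split; first by apply/ES/map_f.
  by apply: hg; apply: map_f.
have [[S0 Slin] SM] := Ssub.
split.
  split; first split.
  - by rewrite /C (nhom0 hf) nmul0l nmul0r.
  - move=> a x y [Sx [gx xg]] [Sy [gy yg]]; split.
      by rewrite hf.1; apply: Slin.
    by rewrite nmulDr nmulDl nmulZr nmulZl gx gy xg yg.
  - move=> x y [Sx [gx xg]] [Sy [gy yg]]; split.
      by rewrite hf.2; apply: SM.
    by rewrite nmulA gx -nmulA yg.
exists g.2; split; first by apply/CP; rewrite -gE gg.
split; first by move=> x [].
move=> x /CP [Sx [gx xg]].
(* Compressing a quasi-inverse of [x] by [g] puts it in the corner and keeps [x y x = x]. *)
have [|y' [y1 Sy'] xyx'] := regW (uin x); first by [].
pose y := g * y' * g.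
have Ay : scalar_add S (F y) by case: (WgAg y').
have gy : g * y = y by rewrite /y !mulrA gg.
have yg : y * g = y by rewrite /y -!mulrA gg.
have xyx : uin x * y * uin x = uin x.
  by rewrite /y 2!mulrA xg -mulrA gx.
pose k := 1 - g; have gk1 : g + k = 1 by rewrite /k addrC subrK.
have Ag : scalar_add S (F g) by [].
have A1 : scalar_add S (F 1) by rewrite rmorph1.
have Ak : scalar_add S (F k) by apply: (lsubB hA.1 A1 Ag).
have Axk : scalar_add S (F (uin x + k)) by apply: (lsubD hA.1).
have Ayk : scalar_add S (F (y + k)) by apply: (lsubD hA.1).
(* In [K + R0] the element [y + k] is a quasi-inverse of [x + k]; the unit obtained from this pair
   is cut back to the corner by [corner_unit]. *)
have [|t [v [At [Av [uv vu]]]]] :=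
    preim_stable_range1 F_surj F_ur hP P1 Ps regP Axk Ayk.
  by rewrite !(corner_mul gg gk1) ?xyx // -mulrA yg.
set u := _ + _ * t in uv vu.
have Au : scalar_add S (F u).
  apply: (lsubD hA.1 Axk); apply: (hA.2 _ t _ At).
  by apply: (lsubB hA.1 A1); apply: (hA.2 _ _ Axk Ayk).
have [e1 e2 e3] := corner_unit gg gk1 gx xg gy yg xyx erefl uv vu.
have [u0 Cu0 u0E] := C_corner u Au; have [v0 Cv0 v0E] := C_corner v Av.
move: e1 e2 e3; rewrite u0E v0E !uin_mul {1 2}gE => /uin_inj e1 /uin_inj e2.
by move=> /uin_inj e3; exists v0, u0.
Qed.

Lemma zero_loc_unit_regular (K : fieldType) (R : nalg K) :
  loc_unit_regular (fun x : R => x = 0).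
Proof.
move=> E hE; exists (fun x => x = 0); split=> //; split=> //; split.
  split; first by split=> // a x y -> ->; rewrite scaler0 addr0.
  by move=> x y -> ->; rewrite nmul0l.
exists 0; split=> //; split; first by move=> x ->; rewrite nmul0l.
by move=> x ->; exists 0, 0; rewrite !nmul0l.
Qed.

(** This is the extension result for the zero ideal and the identity map; it makes a locally f.d.ss
    ideal admissible as a kernel. *)
Lemma loc_fdss_loc_unit_regular (K : fieldType) (R : nalg K) :
  loc_fdss (fun _ : R => True) -> loc_unit_regular (fun _ : R => True).
Proof.
apply: (@extension_loc_unit_regular K R R (fun x => x = 0) id) => //.
- by move=> q; exists q.
- exact: zero_loc_unit_regular.
Qed.

(** The equations for the identity and the units survive under [phi], and a finite subset of [J]
    lifts elementwise to [A]. *)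
Lemma image_loc_unit_regular (K : fieldType) (A B : nalg K) (phi : A -> B)
    (J : B -> Prop) : nhom phi -> (forall y, J y <-> exists x, y = phi x) ->
  loc_unit_regular (fun _ : A => True) -> loc_unit_regular J.
Proof.
move=> hphi Jphi urA E EJ.
have [E' EE'] : exists E', E = map phi E'.
  elim: E EJ => [|y E IHE] EJ; first by exists [::].
  have [|E' ->] := IHE; first by move=> z zE; apply: EJ; rewrite inE zE orbT.
  have /Jphi [x ->] : J y by apply: EJ; rewrite inE eqxx.
  by exists (x :: E').
have [//|S [_ [E'S [[[S0 Slin] SM] [e [Se [ide reg]]]]]]] := urA E'.
exists (fun y => exists2 x, S x & y = phi x); split.
  by move=> y [x _ ->]; apply/Jphi; exists x.
split; first by move=> y; rewrite EE' => /mapP [x /E'S Sx ->]; exists x.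
split.
  split; first split.
  - by exists 0; rewrite ?(nhom0 hphi).
  - move=> a _ _ [x Sx ->] [y Sy ->]; exists (a *: x + y); first exact: Slin.
    by rewrite hphi.1.
  - move=> _ _ [x Sx ->] [y Sy ->]; exists (nmul A x y); first exact: SM.
    by rewrite hphi.2.
exists (phi e); split; first by exists e.
split.
  by move=> _ [x Sx ->]; rewrite -!hphi.2; have [-> ->] := ide x Sx.
move=> _ [x /reg [u [v [Su [Sv [uv [vu xux]]]]]] ->].
exists (phi u), (phi v); split; first by exists u.
by split; [exists v | rewrite -!hphi.2 uv vu xux].
Qed.

Theorem theorem5p6 (K : fieldType) :
  (forall (R Q : nalg K) (J : R -> Prop) (f : R -> Q),
     ideal J ->
     (* Q is (a model of) R/J: f is a surjective hom with kernel J *)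
     nhom f -> (forall q, exists r, f r = q) -> (forall r, f r = 0 <-> J r) ->
     loc_unit_regular J -> loc_fdss (fun _ : Q => True) ->
     loc_unit_regular (fun _ : R => True)) /\
  (forall A B C : nalg K,
     loc_fdss (fun _ : A => True) -> loc_fdss (fun _ : C => True) ->
     is_extension A B C -> loc_unit_regular (fun _ : B => True)).
Proof.
split=> [R Q J f _|A B C fdssA fdssC].
  exact: extension_loc_unit_regular.
move=> [J [_ [[phi [hphi [_ Jphi]]] [psi [hpsi [psi_surj kerpsi]]]]]].
apply: (extension_loc_unit_regular hpsi psi_surj kerpsi) => //.
apply: (image_loc_unit_regular hphi Jphi).
exact: loc_fdss_loc_unit_regular.
Qed.
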